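(* Let $G$ be a compact Hausdorff group, let $X$ be a compact Hausdorff space, and let $G$ act continuously on $X$. Denote by $\alpha\colon G\to{\rm Aut}(C(X))$ the induced action. Then $${\rm ind}_G(X)=\dim_{\rm LT}(\alpha).$$
   Context: $G$ acts on $X$ from the right, and $(\alpha_g f)(x)=f(xg)$. $G$ acts on $C(G)$ by the action induced by right translation of $G$ on itself, and on $C_0((0,1])\otimes C(G)$ by the trivial action on the first factor and this translation action on the second (equivalently, via the coaction ${\rm id}\otimes\Delta$, where $\Delta$ is the usual comultiplication of $C(G)$). Multi-joins: the topological join is $X\ast Y:=(X\times Y\times[0,1])/\sim$ with $(x,y,1)\sim(x',y,1)$ and $(x,y,0)\sim(x,y',0)$ for all $x,x'\in X$, $y,y'\in Y$. Set $E_0G:=G$ and $E_nG:=G\ast\cdots\ast G$ ($n+1$ copies), with the diagonal translation action of $G$. $G$-index: ${\rm ind}_G(X)$ is the minimal integer $n\geq 0$ such that there exists a $G$-equivariant continuous map $X\to E_nG$, and ${\rm ind}_G(X)=\infty$ if there is no such map for any $n$. Local-triviality dimension: let ${\rm t}\in C_0((0,1])$ be the inclusion function $(0,1]\hookrightarrow\mathbb{C}$. Then $\dim_{\rm LT}(\alpha)$ is the minimal integer $d\ge0$ such that there exist $G$-equivariant (not necessarily unital) $*$-homomorphisms $\rho_0,\ldots,\rho_d\colon C_0((0,1])\otimes C(G)\to C(X)$ with $\sum_{j=0}^d\rho_j({\rm t}\otimes 1)=1$, and $\infty$ if no such $d$ exists. *)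

(* Defs.v *)
From HB Require Import structures.
From mathcomp Require Import all_boot all_order all_algebra.
From mathcomp Require Import all_classical all_reals all_analysis.
From mathcomp Require Import complex.

Set Implicit Arguments.
Unset Strict Implicit.
Unset Printing Implicit Defensive.

Import Order.TTheory GRing.Theory Num.Theory.
Import numFieldNormedType.Exports.

Local Open Scope classical_set_scope.
Local Open Scope ring_scope.
Local Open Scope quotient_scope.

(* Ascribing R[i] to numClosedFieldType makes the topology of its norm
   available. *)
Definition Cplx (R : realType) : numClosedFieldType := R[i].

HB.mixin Record isTopologicalGroup G of Group G & Topological G := {
  mulg_continuous : continuous (fun p : G * G => (p.1 * p.2)%g);
  invg_continuous : continuous (fun g : G => (g^-1)%g)
}.

#[short(type="topologicalGroupType")]
HB.structure Definition TopologicalGroup :=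
  { G of isTopologicalGroup G & Group G & Topological G }.

Record continuous_right_action (G : topologicalGroupType)
    (X : topologicalType) (act : X -> G -> X) : Prop := {
  ract1 : forall x, act x 1%g = x;
  ractM : forall x g h, act x (g * h)%g = act (act x g) h;
  ract_continuous : continuous (fun p : X * G => act p.1 p.2)
}.

Lemma regular_continuous_right_action (G : topologicalGroupType) :
  continuous_right_action (fun h g : G => (h * g)%g).
Proof.
split; [exact: mulg1 | by move=> x g h; rewrite mulgA |].
exact: mulg_continuous.
Qed.

(* Least element of P, with None playing the role of infinity. *)
Definition least (P : nat -> Prop) : option nat :=
  if pselect (exists n, `[< P n >]) is left exP then Some (ex_minn exP)
  else None.

Lemma least_Some (P : nat -> Prop) (n : nat) :
  least P = Some n <-> P n /\ forall m, P m -> (n <= m)%N.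
Proof.
rewrite /least; case: pselect => [exP|nexP].
  case: ex_minnP => m /asboolP Pm minm; split=> [[<-]|[Pn minn]].
    by split=> // k Pk; apply: minm; apply/asboolP.
  congr Some; apply/eqP; rewrite eqn_leq minn// minm//.
  exact/asboolP.
by split=> // -[Pn _]; case: nexP; exists n; apply/asboolP.
Qed.

Lemma least_None (P : nat -> Prop) : least P = None <-> forall n, ~ P n.
Proof.
rewrite /least; case: pselect => [exP|nexP].
  by split=> // nP; have [n /asboolP /nP] := exP.
by split=> // _ n Pn; apply: nexP; exists n; apply/asboolP.
Qed.

Section Join.
Context (R : realType).

Definition unit_interval : topologicalType := set_type `[0 : R, 1]%classic.

Section JoinOf.
Context (X Y : topologicalType).

(* The relation (x,y,1) ~ (x',y,1), (x,y,0) ~ (x,y',0) together with equality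
   is already transitive. *)
Let join_rel' (p q : X * Y * unit_interval) : bool :=
  [|| p == q,
      [&& p.1.2 == q.1.2, \val p.2 == 1 & \val q.2 == 1]
    | [&& p.1.1 == q.1.1, \val p.2 == 0 & \val q.2 == 0]].

Local Lemma join_rel_refl : reflexive join_rel'.
Proof. by move=> p; rewrite /join_rel' eqxx. Qed.

Local Lemma join_rel_sym : symmetric join_rel'.
Proof.
move=> p q; rewrite /join_rel' (eq_sym p) (eq_sym p.1.1) (eq_sym p.1.2).
by rewrite ![(\val p.2 == _) && _]andbC.
Qed.

Local Lemma join_rel_trans : transitive join_rel'.
Proof.
move=> q p r /or3P[/eqP->//|/and3P[/eqP pq /eqP p1 /eqP q1]|
  /and3P[/eqP pq /eqP p0 /eqP q0]] /or3P[/eqP<-|/and3P[/eqP qr a b]|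
  /and3P[/eqP qr a b]]; rewrite /join_rel'.
- by rewrite pq p1 q1 !eqxx ?orbT.
- by rewrite pq qr p1 b !eqxx ?orbT.
- by move: a; rewrite q1 oner_eq0.
- by rewrite pq p0 q0 !eqxx ?orbT.
- by move: a; rewrite q0 eq_sym oner_eq0.
- by rewrite pq qr p0 b !eqxx ?orbT.
Qed.

Definition join_rel := EquivRel _ join_rel_refl join_rel_sym join_rel_trans.

Lemma join_relE p q : join_rel p q =
  [|| p == q,
      [&& p.1.2 == q.1.2, \val p.2 == 1 & \val q.2 == 1]
    | [&& p.1.1 == q.1.1, \val p.2 == 0 & \val q.2 == 0]].
Proof. by []. Qed.

Definition join := {eq_quot join_rel}.

HB.instance Definition _ := Topological.copy join (quotient_topology join).
HB.instance Definition _ := Quotient.on join.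

End JoinOf.

Section JoinAction.
Context (G : Type) (X Y : topologicalType).
Context (actX : X -> G -> X) (actY : Y -> G -> Y).

Definition join_act (q : join X Y) (g : G) : join X Y :=
  let p := repr q in \pi_(join X Y) (actX p.1.1 g, actY p.1.2 g, p.2).

Lemma join_actE x y t g :
  join_act (\pi_(join X Y) (x, y, t)) g =
  \pi_(join X Y) (actX x g, actY y g, t).
Proof.
rewrite /join_act; case: piP => -[[x' y'] t'] /eqmodP.
rewrite join_relE /= => /or3P[/eqP[-> -> ->]//|/and3P[/eqP-> a b]|
  /and3P[/eqP-> a b]]; apply/eqmodP; rewrite join_relE /= eqxx a b ?orbT//.
Qed.

End JoinAction.

Section EnG.
Context (G : topologicalGroupType).

Fixpoint EnG (n : nat) : topologicalType :=
  if n is m.+1 then join (EnG m) G else G.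

Fixpoint EnG_act (n : nat) : EnG n -> G -> EnG n :=
  if n is m.+1 return EnG n -> G -> EnG n
  then join_act (@EnG_act m) (fun h g => (h * g)%g)
  else fun h g => (h * g)%g.

Definition ind (X : topologicalType) (act : X -> G -> X) : option nat :=
  least (fun n => exists f : X -> EnG n,
    continuous f /\ forall x g, f (act x g) = EnG_act (f x) g).

End EnG.
End Join.

Section FunctionAlgebras.
Context (R : realType).
Local Notation C := (Cplx R).

(* Commutative C*-algebras are represented as sets of complex functions, with
   the pointwise operations of the function type and the supremum norm. *)
Definition Ccont (X : topologicalType) : set (X -> C) :=
  [set f | continuous f].

Definition C0 (X : topologicalType) : set (X -> C) :=
  [set f | continuous f /\ forall e : C, 0 < e ->
    exists K : set X, compact K /\ forall x, ~ K x -> `|f x| < e].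

Definition tens (S T : Type) (f : S -> C) (g : T -> C) : S * T -> C :=
  fun p => f p.1 * g p.2.

Definition alg_tensor (S T : Type) (A : set (S -> C)) (B : set (T -> C)) :
    set (S * T -> C) :=
  [set F | exists (n : nat) (f : 'I_n -> S -> C) (g : 'I_n -> T -> C),
    (forall i, A (f i) /\ B (g i)) /\ F = \sum_(i < n) tens (f i) (g i)].

(* The C*-tensor product: A and B act faithfully by multiplication on l^2(S)
   and l^2(T), so the spatial tensor product is the closure of the algebraic
   one among the multiplication operators on l^2(S x T), whose operator norm is
   the supremum norm. *)
Definition tensor (S T : Type) (A : set (S -> C)) (B : set (T -> C)) :
    set (S * T -> C) :=
  [set F | forall e : C, 0 < e ->
    exists2 H, alg_tensor A B H & forall p, `|F p - H p| <= e].

(* Not necessarily unital; the values of rho outside A are irrelevant. *)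
Record star_hom (S T : Type) (A : set (S -> C)) (B : set (T -> C))
    (rho : (S -> C) -> T -> C) : Prop := {
  star_hom_fun : forall f, A f -> B (rho f);
  star_hom_linear : forall (a : C) f g, A f -> A g ->
    rho (a *: f + g) = a *: rho f + rho g;
  star_hom_mul : forall f g, A f -> A g -> rho (f * g) = rho f * rho g;
  star_hom_star : forall f, A f ->
    rho (fun s => (f s)^*) = (fun t => (rho f t)^*)
}.

Section Actions.
Context (G : topologicalGroupType).

Definition induced_action (X : Type) (act : X -> G -> X) (g : G)
    (f : X -> C) : X -> C := fun x => f (act x g).

Lemma induced_action_star_hom (X : topologicalType) (act : X -> G -> X)
    (g : G) : continuous_right_action act ->
  star_hom (@Ccont X) (@Ccont X) (induced_action act g).
Proof.
move=> [_ _ cact]; split=> [f cf x|a f k _ _|f k _ _|f _]; last 3 first.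
- by [].
- by [].
- by [].
rewrite /induced_action.
apply: (@continuous_comp _ _ _ (act^~ g) f); last exact: cf.
apply: (@continuous_comp _ _ _ (fun x => (x, g)) (fun p => act p.1 p.2)).
  by apply: cvg_pair => //=; exact: cvg_cst.
exact: cact.
Qed.

Lemma induced_actionM (X : topologicalType) (act : X -> G -> X) (g h : G) f :
  continuous_right_action act ->
  induced_action act (g * h)%g f =
  induced_action act g (induced_action act h f).
Proof. by move=> [_ actM _]; apply/funext => x; rewrite /induced_action actM. Qed.

Definition translation : G -> (G -> C) -> G -> C :=
  induced_action (fun h g => (h * g)%g).

Definition half_open : topologicalType := set_type `]0 : R, 1]%classic.

Definition t_incl : half_open -> C := fun s => (\val s)%:C%C.

Definition cone_alg : set (half_open * G -> C) :=
  tensor (@C0 half_open) (@Ccont G).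

(* id (x) (translation by g), see cone_action_tens. *)
Definition cone_action : G -> (half_open * G -> C) -> half_open * G -> C :=
  induced_action (fun p g => (p.1, (p.2 * g)%g)).

Lemma cone_action_tens (g : G) (f : half_open -> C) (k : G -> C) :
  cone_action g (tens f k) = tens f (translation g k).
Proof. by []. Qed.

Definition dim_LT (X : Type) (B : set (X -> C))
    (alpha : G -> (X -> C) -> X -> C) : option nat :=
  least (fun d => exists rho : 'I_d.+1 -> (half_open * G -> C) -> X -> C,
    [/\ forall j, star_hom cone_alg B (rho j),
        forall j g F, cone_alg F ->
          rho j (cone_action g F) = alpha g (rho j F) &
        \sum_(j < d.+1) rho j (tens t_incl (cst 1)) = cst 1]).

End Actions.
End FunctionAlgebras.

Arguments Ccont {R} X.

(* Main.v *)
Require Import Defs.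
From mathcomp Require Import all_boot all_order all_algebra.
From mathcomp Require Import all_classical all_reals all_analysis.
From mathcomp Require Import complex.
From mathcomp Require Import ring lra.

(** Both minima range over the same set of integers [n], because both existence
    conditions at [n] are equivalent to the existence of one kind of data on
    [X] ([equivariant_coordinates]): invariant continuous weights
    [t_0, ..., t_n >= 0] with sum [1], and vertices [g_j] with values in [G],
    continuous and equivariant wherever [t_j > 0].

    On the topological side, a point of [E_n G] is a formal convex combination
    of [n + 1] elements of [G] in which an element of weight [0] is forgotten.
    The weights are continuous on [E_n G], and the [j]-th element is continuous
    where its weight is positive ([open_vertex_preimage]), so that an
    equivariant map into [E_n G] is a system of coordinates
    ([equivariant_map_coordinates]).  Conversely, coordinates can be joined
    into a map ([coordinates_equivariant_map]).  Its continuity is an issue only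
    at points where a weight vanishes: there the forgotten factor may
    oscillate, and since it is compact the tube lemma shows that the
    oscillation is invisible in the quotient ([cvg_join1], [cvg_join0]).

    On the algebraic side, composing a *-homomorphism from
    [C_0((0,1]) (x) C(G)] to [C(X)] with the evaluation at a point [x] gives
    either [0] or the evaluation at a point [(t(x), g(x))] of [(0,1] x G].
    Given coordinates, [F |-> F(t_j(x), g_j(x))], extended by [0] where
    [t_j(x) = 0], is continuous because [F] is uniformly small near [0]
    ([coordinates_star_homs]).  Given [rho], the weight is [rho(t (x) 1)], which
    is nonnegative because [t] is a square of a real function; the functional
    [k |-> rho(t (x) k)(x) / rho(t (x) 1)(x)] is a unital *-character of [C(G)],
    hence an evaluation by compactness ([character_point]), and Urysohn
    functions on [G] show that the point so obtained depends continuously and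
    equivariantly on [x] ([star_homs_coordinates]).  Under this correspondence
    [sum_j rho_j(t (x) 1) = 1] says that the weights add up to [1]. *)

Set Implicit Arguments.
Unset Strict Implicit.
Unset Printing Implicit Defensive.

Import Order.TTheory GRing.Theory Num.Theory.
Import numFieldNormedType.Exports.

Local Open Scope classical_set_scope.
Local Open Scope ring_scope.
Local Open Scope quotient_scope.

(** * Complex-valued functions and subspaces of the line *)

Section ComplexContinuity.
Context (R : realType).
Local Notation C := (Cplx R).

Lemma real_complex_continuous : continuous (fun r : R => r%:C%C : C).
Proof.
move=> r; apply/(@cvgrPdist_lt C C) => e e0.
have /complex_realP[d de] : e \is Num.real by exact: gtr0_real.
rewrite de in e0 *.
have d0 : 0 < d by rewrite -ltcR.
near=> s.
rewrite -rmorphB /= normc_def /= expr0n addr0 sqrtr_sqr ltcR.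
near: s.
exact: (nbhs_ball_norm r (PosNum d0)).
Unshelve. all: by end_near. Qed.

Lemma Re_continuous : continuous (fun z : C => complex.Re z : R).
Proof.
move=> z; apply/(@cvgrPdist_lt R R C (nbhs z) (nbhs_filter z)) => e e0.
near=> w.
rewrite -ltcR.
have -> : complex.Re z - complex.Re w = complex.Re (z - w).
  by case: (z) (w) => ? ? [].
apply: le_lt_trans (normc_ge_Re _) _.
near: w.
have e0' : 0 < e%:C%C :> C by rewrite ltcR.
exact: (nbhs_ball_norm z (PosNum e0')).
Unshelve. all: by end_near. Qed.

Lemma conj_continuous : continuous (fun z : C => z^* : C).
Proof.
move=> z; apply/(@cvgrPdist_lt C C C (nbhs z) (nbhs_filter z)) => e e0.
near=> w.
rewrite -rmorphB norm_conjC.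
near: w.
exact: (nbhs_ball_norm z (PosNum e0)).
Unshelve. all: by end_near. Qed.
End ComplexContinuity.

Lemma continuous_sig (T S : topologicalType) (A : set S) (f : T -> S)
    (fA : forall x, A (f x)) :
  continuous f -> continuous (fun x => SigSub (mem_set (fA x)) : A).
Proof.
move=> cf; apply: (@continuous_comp_initial _ _ _ (fun a : A => \val a)).
exact: cf.
Qed.

Lemma val_continuous (S : topologicalType) (A : set S) :
  continuous (fun a : A => \val a).
Proof. exact: initial_continuous. Qed.

Section UnitInterval.
Context (R : realType).

Lemma clip_continuous (a b : R) : continuous (fun r => Num.max a (Num.min b r)).
Proof.
move=> r; apply: continuous_max; first exact: cvg_cst.
by apply: continuous_min; [exact: cvg_cst|exact: cvg_id].
Qed.

Lemma clamp_subproof (r : R) : `[0 : R, 1]%classic (Num.max 0 (Num.min 1 r)).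
Proof. by rewrite /= in_itv /= le_max lexx /= ge_max ler01 ge_min lexx. Qed.

(** A continuous retraction of the line onto the interval, so that continuity of
    interval-valued maps can be checked on real-valued ones. *)
Definition clamp (r : R) : unit_interval R :=
  SigSub (mem_set (clamp_subproof r)).

Lemma clampK (r : R) : 0 <= r <= 1 -> \val (clamp r) = r.
Proof. by move=> /andP[r0 r1] /=; rewrite (min_idPr r1) (max_idPr r0). Qed.

Lemma clamp_continuous : continuous clamp.
Proof. exact/continuous_sig/clip_continuous. Qed.

Lemma unit_interval_itv (s : unit_interval R) : 0 <= \val s <= 1.
Proof. by have := set_valP s; rewrite /= in_itv. Qed.

Lemma compact_unit_interval : compact [set: unit_interval R].
Proof.
have -> : [set: unit_interval R] = clamp @` `[0, 1].
  apply/seteqP; split=> // s _; exists (\val s); first exact: set_valP.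
  by apply/val_inj; rewrite clampK// unit_interval_itv.
apply: continuous_compact; last exact: segment_compact.
exact/continuous_subspaceT/clamp_continuous.
Qed.

End UnitInterval.

(** * Barycentric coordinates on the iterated join *)

Section Barycentric.
Context (R : realType) (G : topologicalGroupType).
Local Notation E := (EnG R G).

(** In [join X Y] the end [1] of the interval is the copy of [Y]; the last copy
    of [G] therefore has weight [s] and the others are scaled by [1 - s]. *)
Fixpoint weight n : E n -> nat -> R :=
  if n is m.+1 return E n -> nat -> R then fun q j =>
    let p := repr (q : join R (E m) G) in
    if j == m.+1 then \val p.2 else (1 - \val p.2) * weight p.1.1 j
  else fun _ j => (j == 0%N)%:R.

(** Read off from a chosen representative, hence meaningful only where the
    corresponding weight is positive; see [vertex_pi]. *)
Fixpoint vertex n : E n -> nat -> G :=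
  if n is m.+1 return E n -> nat -> G then fun q j =>
    let p := repr (q : join R (E m) G) in
    if j == m.+1 then p.1.2 else vertex p.1.1 j
  else fun g _ => g.

Lemma join_ind n (P : E n.+1 -> Prop) :
  (forall a g t, P (\pi_(join R (E n) G) (a, g, t))) -> forall q, P q.
Proof.
move=> H q; pose p := repr (q : join R (E n) G).
have := H p.1.1 p.1.2 p.2.
by rewrite -!surjective_pairing reprK.
Qed.

Lemma weightS n (q : E n.+1) j : weight q j =
  if j == n.+1 then \val (repr (q : join R (E n) G)).2
  else (1 - \val (repr (q : join R (E n) G)).2) *
       weight (repr (q : join R (E n) G)).1.1 j.
Proof. by []. Qed.

Lemma vertexS n (q : E n.+1) j : vertex q j =
  if j == n.+1 then (repr (q : join R (E n) G)).1.2
  else vertex (repr (q : join R (E n) G)).1.1 j.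
Proof. by []. Qed.

Lemma weight_pi n a g t j : @weight n.+1 (\pi_(join R (E n) G) (a, g, t)) j =
  if j == n.+1 then \val t else (1 - \val t) * weight a j.
Proof.
rewrite weightS; case: piP => -[[a' g'] t'] /eqmodP.
rewrite join_relE.
move=> /or3P[/eqP[-> _ ->]//|/and3P[_ /eqP t1 /eqP t1']|
  /and3P[/eqP aa /eqP t0 /eqP t0']].
  by rewrite [\val t']t1' [\val t]t1 subrr !mul0r.
by rewrite [\val t']t0' [\val t]t0 [a]aa.
Qed.

(** Positivity of the weight excludes the end of the interval at which the
    [j]-th element is collapsed, so it does not depend on the representative. *)
Lemma vertex_pi n a g t j :
  0 < @weight n.+1 (\pi_(join R (E n) G) (a, g, t)) j ->
  @vertex n.+1 (\pi_(join R (E n) G) (a, g, t)) j =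
  if j == n.+1 then g else vertex a j.
Proof.
rewrite weight_pi vertexS; case: piP => -[[a' g'] t'] /eqmodP.
rewrite join_relE; have [_|_] := eqVneq j n.+1;
  move=> /or3P[/eqP[ea eg _]|/and3P[/eqP e /eqP t1 _]|/and3P[/eqP e /eqP t0 _]].
- by rewrite eg.
- by rewrite [g]e.
- by rewrite t0 ltxx.
- by rewrite ea.
- by rewrite t1 subrr mul0r ltxx.
- by rewrite [a]e.
Qed.

Lemma weight_ge0 n (q : E n) j : 0 <= weight q j.
Proof.
elim: n q => [|n IH] q; first by rewrite /= ler0n.
elim/join_ind: q => a g t; rewrite weight_pi.
have /andP[t0 t1] := unit_interval_itv t.
by case: ifP => // _; rewrite mulr_ge0 ?subr_ge0.
Qed.

Lemma weight_sum n (q : E n) : \sum_(j < n.+1) weight q j = 1.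
Proof.
elim: n q => [|n IH] q; first by rewrite big_ord1.
elim/join_ind: q => a g t.
rewrite big_ord_recr weight_pi /= eqxx.
rewrite (eq_bigr (fun j : 'I_n.+1 => (1 - \val t) * weight a j)) => [|j _];
  last first.
  by rewrite -/(@weight n.+1 _ _) weight_pi ltn_eqF.
by rewrite -mulr_sumr IH mulr1 subrK.
Qed.

Lemma weight_continuous n j : continuous (fun q : E n => weight q j).
Proof.
elim: n => [|n IH]; first exact: cst_continuous.
apply: (@quotient_continuous _ (join R (E n) G) _
  (fun q : E n.+1 => weight q j)).2.
have -> : (fun q : E n.+1 => weight q j) \o \pi_(join R (E n) G) =
    fun p => if j == n.+1 then \val p.2 else (1 - \val p.2) * weight p.1.1 j.
  by apply/funext => -[[a g] t]; rewrite /comp weight_pi.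
case: eqP => _.
  move=> p; apply: (@continuous_comp _ _ _ snd
    (fun t : unit_interval R => \val t)).
    exact: cvg_snd.
  exact: val_continuous.
move=> p; apply: cvgM.
  apply: cvgB; first exact: cvg_cst.
  apply: (@continuous_comp _ _ _ snd
    (fun t : unit_interval R => \val t)).
    exact: cvg_snd.
  exact: val_continuous.
apply: (@continuous_comp _ _ _
  (fun p : E n * G * unit_interval R => p.1.1) (fun a => weight a j)).
  by apply: (@continuous_comp _ _ _ fst fst); exact: cvg_fst.
exact: IH.
Qed.

(** Continuity of the [j]-th vertex on the locus where it is well defined.
    Stating it for open sets, with the positivity inside the set, reduces it
    to the openness of a saturated set of triples. *)
Lemma open_vertex_preimage n j (U : set G) : open U ->
  open [set q : E n | 0 < weight q j /\ U (vertex q j)].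
Proof.
move=> oU; elim: n => [|n IH].
  have [->|/negbTE j0] := eqVneq j 0%N.
    rewrite (_ : [set q | _] = U)//.
    by apply/seteqP; split=> x /=; [case|rewrite ltr01].
  rewrite (_ : [set q | _] = set0); first exact: open0.
  by apply/seteqP; split=> x //=; rewrite j0 ltxx; case.
change (open (\pi_(join R (E n) G) @^-1`
  [set q : E n.+1 | 0 < weight q j /\ U (vertex q j)])).
have c1 : continuous (fun p : E n * G * unit_interval R => \val p.2).
  move=> p; apply: (@continuous_comp _ _ _ snd
    (fun t : unit_interval R => \val t)).
    exact: cvg_snd.
  exact: val_continuous.
(* S describes the preimage in terms of the representative only. *)
pose S (p : E n * G * unit_interval R) :=
  if j == n.+1 then 0 < \val p.2 /\ U p.1.2
  else \val p.2 < 1 /\ (0 < weight p.1.1 j /\ U (vertex p.1.1 j)).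
have -> : \pi_(join R (E n) G) @^-1`
    [set q : E n.+1 | 0 < weight q j /\ U (vertex q j)] = S.
  apply/funext => -[[a g] t]; apply/propext.
  change ((0 < @weight n.+1 (\pi_(join R (E n) G) (a, g, t)) j /\
    U (@vertex n.+1 (\pi_(join R (E n) G) (a, g, t)) j)) <-> S (a, g, t)).
  have pos : (0 < @weight n.+1 (\pi_(join R (E n) G) (a, g, t)) j) =
      if j == n.+1 then 0 < \val t else (\val t < 1) && (0 < weight a j).
    rewrite weight_pi; case: ifP => // _; have /andP[t0] := unit_interval_itv t.
    rewrite le_eqVlt => /predU1P[->|t1]; first by rewrite subrr mul0r !ltxx.
    by rewrite t1 pmulr_rgt0// subr_gt0.
  have vE := @vertex_pi n a g t j; rewrite /S; split=> [[h]|h].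
    by rewrite vE//; move: h; rewrite pos; case: ifP => // _ /andP[].
  have h' : 0 < @weight n.+1 (\pi_(join R (E n) G) (a, g, t)) j.
    by rewrite pos; move: h; case: ifP => _; [case|move=> [-> []]].
  by split=> //; rewrite vE//; move: h; case: ifP => _; [case|move=> [_ []]].
rewrite /S; case: eqP => _.
  rewrite (_ : (fun _ => _) =
      (fun p => \val p.2) @^-1` [set r : R | 0 < r] `&` (snd \o fst) @^-1` U)//.
  apply: openI; apply: open_comp => //.
  by move=> p _; apply: continuous_comp; [exact: cvg_fst|exact: cvg_snd].
rewrite (_ : (fun _ => _) =
    (fun p => \val p.2) @^-1` [set r : R | r < 1] `&`
    (fst \o fst) @^-1` [set a | 0 < weight a j /\ U (vertex a j)])//.
apply: openI; apply: open_comp => //.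
by move=> p _; apply: continuous_comp; exact: cvg_fst.
Qed.

Lemma weight_act n (q : E n) g j : weight (EnG_act q g) j = weight q j.
Proof.
elim: n q => // n IH q; elim/join_ind: q => a h t.
by rewrite [EnG_act _ _]join_actE !weight_pi IH.
Qed.

Lemma vertex_act n (q : E n) g j : 0 < weight q j ->
  vertex (EnG_act q g) j = (vertex q j * g)%g.
Proof.
elim: n q => // n IH q; elim/join_ind: q => a h t q0.
have := q0; rewrite -(weight_act _ g) [EnG_act _ _]join_actE => q0'.
rewrite !vertex_pi//; case: ifPn => // jn; apply: IH.
have /andP[t0 t1] := unit_interval_itv t.
rewrite lt_neqAle weight_ge0 andbT; apply: contraTneq q0 => a0.
by rewrite weight_pi (negbTE jn) -a0 mulr0 ltxx.
Qed.

End Barycentric.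

(** * Convergence in a join of compact spaces *)

Section JoinTopology.
Context (R : realType) (X Y : topologicalType).
Local Notation J := (join R X Y).

Lemma join_eq1 (a a' : X) (b : Y) (s : unit_interval R) : \val s = 1 ->
  \pi_J (a, b, s) = \pi_J (a', b, s).
Proof. by move=> s1; apply/eqmodP; rewrite join_relE /= eqxx s1 eqxx orbT. Qed.

Lemma join_eq0 (a : X) (b b' : Y) (s : unit_interval R) : \val s = 0 ->
  \pi_J (a, b, s) = \pi_J (a, b', s).
Proof. by move=> s0; apply/eqmodP; rewrite join_relE /= eqxx s0 eqxx !orbT. Qed.

Lemma compact_join : compact [set: X] -> compact [set: Y] -> compact [set: J].
Proof.
move=> cX cY.
have -> : [set: J] = \pi_J @` [set: X * Y * unit_interval R].
  by apply/seteqP; split=> // q _; exists (repr q) => //; rewrite reprK.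
apply: continuous_compact; first exact/continuous_subspaceT/pi_continuous.
rewrite -[[set: _ * _ * _]]setXTT -setXTT.
by apply: compact_setX; [exact: compact_setX|exact: compact_unit_interval].
Qed.

Lemma cvg_join (T : Type) (F : set_system T) {FF : Filter F} (a : T -> X)
    (b : T -> Y) (s : T -> unit_interval R) (x : X) (y : Y)
    (r : unit_interval R) :
  a @ F --> x -> b @ F --> y -> s @ F --> r ->
  (fun p => \pi_J (a p, b p, s p)) @ F --> \pi_J (x, y, r).
Proof.
move=> ax bx sx.
apply: (@cvg_comp _ _ _ (fun p => (a p, b p, s p)) \pi_J F (nbhs (x, y, r))).
  apply: (@cvg_pair _ _ _ F (nbhs (x, y)) (nbhs r) _ _ _
    (fun p => (a p, b p)) s) => //.
  exact: (@cvg_pair _ _ _ F (nbhs x) (nbhs y)).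
exact: pi_continuous.
Qed.

(** Tube lemma: all the points [(a, y, 1)] are identified, so a neighbourhood of
    their common class pulls back to a neighbourhood of the whole slice
    [X * {y} * {1}]; by compactness of [X] it contains a tube around it, and [a]
    may vary arbitrarily. *)
Lemma cvg_join1 (T : Type) (F : set_system T) {FF : Filter F} (a : T -> X)
    (b : T -> Y) (s : T -> unit_interval R) (x : X) (y : Y)
    (r : unit_interval R) : compact [set: X] ->
  \val r = 1 -> b @ F --> y -> s @ F --> r ->
  (fun p => \pi_J (a p, b p, s p)) @ F --> \pi_J (x, y, r).
Proof.
move=> /compact_near_coveringP cX r1 bx sx W Wn.
have : \forall p \near F, [set: X] `<=` (fun a' => W (\pi_J (a', b p, s p))).
  apply: cX => a' _.
  have : (fun p : X * T => \pi_J (p.1, b p.2, s p.2)) @ filter_prod (nbhs a') F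
      --> \pi_J (a', y, r).
    apply: cvg_join; first exact: cvg_fst.
    - by apply: (@cvg_comp _ _ _ snd b _ F) => //; exact: cvg_snd.
    - by apply: (@cvg_comp _ _ _ snd s _ F) => //; exact: cvg_snd.
  by apply; rewrite (join_eq1 _ x).
by apply: filterS => p; apply.
Qed.

(** The mirror image of [cvg_join1], at the end where [Y] is collapsed. *)
Lemma cvg_join0 (T : Type) (F : set_system T) {FF : Filter F} (a : T -> X)
    (b : T -> Y) (s : T -> unit_interval R) (x : X) (y : Y)
    (r : unit_interval R) : compact [set: Y] ->
  \val r = 0 -> a @ F --> x -> s @ F --> r ->
  (fun p => \pi_J (a p, b p, s p)) @ F --> \pi_J (x, y, r).
Proof.
move=> /compact_near_coveringP cY r0 ax sx W Wn.
have : \forall p \near F, [set: Y] `<=` (fun b' => W (\pi_J (a p, b', s p))).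
  apply: cY => b' _.
  have : (fun p : Y * T => \pi_J (a p.2, p.1, s p.2)) @ filter_prod (nbhs b') F
      --> \pi_J (x, b', r).
    apply: cvg_join; [|exact: cvg_fst|].
    - by apply: (@cvg_comp _ _ _ snd a _ F) => //; exact: cvg_snd.
    - by apply: (@cvg_comp _ _ _ snd s _ F) => //; exact: cvg_snd.
  by apply; rewrite (join_eq0 _ _ y).
by apply: filterS => p; apply.
Qed.

End JoinTopology.

(** * The point of the iterated join with given coordinates *)

Section EnGPoint.
Context (R : realType) (G : topologicalGroupType).
Local Notation E := (EnG R G).

Lemma compact_EnG n : compact [set: G] -> compact [set: E n].
Proof. by move=> cG; elim: n => // n IH; exact: compact_join. Qed.

(** The first weights are renormalized to have sum [1] again; when the last one
    is [1] the quotients are meaningless but the point they define is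
    collapsed. *)
Fixpoint EnG_point n (t : nat -> R) (g : nat -> G) : E n :=
  if n is m.+1 return E n then
    \pi_(join R (E m) G) (EnG_point m (fun j => t j / (1 - t m.+1)) g,
                          g m.+1, clamp (t m.+1))
  else g 0%N.

Lemma last_weight_le1 n (t : nat -> R) : (forall j, 0 <= t j) ->
  \sum_(j < n.+2) t j = 1 -> 0 <= t n.+1 <= 1.
Proof.
move=> t0 t1; rewrite t0/= -t1 big_ord_recr/= lerDr sumr_ge0//.
Qed.

Lemma renormalized_sum n (t : nat -> R) : t n.+1 < 1 ->
  \sum_(j < n.+2) t j = 1 -> \sum_(j < n.+1) t j / (1 - t n.+1) = 1.
Proof.
move=> tn; rewrite big_ord_recr/= => /(canRL (addrK _)).
by rewrite -mulr_suml => ->; rewrite divff// subr_eq0 gt_eqF.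
Qed.

(** The vertices are compared only where the weight is positive; elsewhere the
    identifications of the join absorb the difference. *)
Lemma EnG_point_act n (t : nat -> R) (g g' : nat -> G) h :
  (forall j, 0 <= t j) -> \sum_(j < n.+1) t j = 1 ->
  (forall j, 0 < t j -> g' j = (g j * h)%g) ->
  EnG_point n t g' = EnG_act (EnG_point n t g) h.
Proof.
elim: n t => [|n IH] t t0 t1 gg'.
  by apply: gg' => //; rewrite big_ord1 in t1; rewrite t1.
rewrite [EnG_act _ _]join_actE /=.
have t01 := last_weight_le1 t0 t1.
set s := clamp _; have sE : \val s = t n.+1 by rewrite clampK.
have IH' : t n.+1 < 1 -> EnG_point n (fun j => t j / (1 - t n.+1)) g' =
    EnG_act (EnG_point n (fun j => t j / (1 - t n.+1)) g) h.
  move=> tn1; apply: IH => [j||j].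
  - by apply: divr_ge0; [exact: t0|rewrite subr_ge0 ltW].
  - exact: renormalized_sum.
  - by rewrite pmulr_lgt0 ?invr_gt0 ?subr_gt0//; exact: gg'.
have [tn1|tn1] := eqVneq (t n.+1) 1.
  by rewrite gg' ?tn1//; apply: join_eq1; rewrite sE.
rewrite IH'; last by rewrite lt_neqAle tn1; case/andP: t01.
have [tn0|tn0] := eqVneq (t n.+1) 0.
  by apply: join_eq0; rewrite sE.
by rewrite gg'// lt_neqAle eq_sym tn0; case/andP: t01.
Qed.

(** Continuity at one point, from hypotheses near it: the renormalized weights
    of the recursive step behave well only where the last weight is [< 1], so
    a global statement would not pass through the induction. *)
Lemma EnG_point_continuous n (T : topologicalType) (x : T)
    (t : T -> nat -> R) (g : T -> nat -> G) :
  compact [set: G] ->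
  (forall j, {for x, continuous (t^~ j)}) ->
  (\forall y \near x, forall j, 0 <= t y j) ->
  (\forall y \near x, \sum_(j < n.+1) t y j = 1) ->
  (forall j, 0 < t x j -> {for x, continuous (g^~ j)}) ->
  {for x, continuous (fun y => EnG_point n (t y) (g y))}.
Proof.
move=> cG; elim: n t => [|n IH] t ct t0 t1 cg.
  apply: cg => //.
  by have := nbhs_singleton t1; rewrite big_ord1 => ->.
have cs : (fun y => clamp (t y n.+1)) @ x --> clamp (t x n.+1).
  by apply: continuous_comp; [exact: ct|exact: clamp_continuous].
have t01 := last_weight_le1 (nbhs_singleton t0) (nbhs_singleton t1).
have IH' : t x n.+1 < 1 ->
    {for x, continuous
      (fun y => EnG_point n (fun j => t y j / (1 - t y n.+1)) (g y))}.
  move=> tn1.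
  have tn1' : \forall y \near x, t y n.+1 < 1.
    exact: (cvgr_lt _ (ct n.+1)).
  apply: IH => [j|||j].
  - apply: cvgM; first exact: ct.
    apply: cvgV; first by rewrite subr_eq0 eq_sym lt_eqF.
    by apply: cvgB; [exact: cvg_cst|exact: ct].
  - near=> y => j.
    have ty0 : forall j, 0 <= t y j by near: y.
    have ty1 : t y n.+1 < 1 by near: y.
    by apply: divr_ge0; [exact: ty0|rewrite subr_ge0 ltW].
  - near=> y; apply: renormalized_sum; by near: y.
  - by rewrite pmulr_lgt0 ?invr_gt0 ?subr_gt0//; exact: cg.
have [tn1|tn1] := eqVneq (t x n.+1) 1.
  apply: cvg_join1 => //; first exact: compact_EnG.
    by rewrite clampK.
  by apply: cg; rewrite ?tn1.
have /IH'{}IH' : t x n.+1 < 1 by rewrite lt_neqAle tn1; case/andP: t01.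
have [tn0|tn0] := eqVneq (t x n.+1) 0.
  by apply: cvg_join0 => //; rewrite clampK.
apply: cvg_join => //; apply: cg => //.
by rewrite lt_neqAle eq_sym tn0; case/andP: t01.
Unshelve. all: by end_near. Qed.

End EnGPoint.

(** * The cone algebra as functions vanishing near 0 *)

Section Cone.
Context (R : realType).
Local Notation C := (Cplx R).
Local Notation H := (half_open R).

Lemma half_open_itv (s : H) : 0 < \val s <= 1.
Proof. by have := set_valP s; rewrite /= in_itv. Qed.

Lemma clip_half_open_subproof (a : R) : 0 < a <= 1 ->
  forall r : R, `]0 : R, 1]%classic (Num.max a (Num.min 1 r)).
Proof.
move=> /andP[a0 a1] r.
by rewrite /= in_itv /= lt_max a0 /= ge_max a1 ge_min lexx.
Qed.

Definition clip_half_open (a : R) (a01 : 0 < a <= 1) (r : R) : H :=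
  SigSub (mem_set (clip_half_open_subproof a01 r)).

Lemma clip_half_open_continuous a (a01 : 0 < a <= 1) :
  continuous (clip_half_open a01).
Proof. exact/continuous_sig/clip_continuous. Qed.

Lemma clip_half_openK a (a01 : 0 < a <= 1) r : a <= r <= 1 ->
  \val (clip_half_open a01 r) = r.
Proof. by move=> /andP[ar r1] /=; rewrite (min_idPr r1) (max_idPr ar). Qed.

(** The compact set outside of which [f] is small has a closed image in the line
    that misses [0]. *)
Lemma C0_near0 (f : H -> C) (e : C) : C0 f -> 0 < e ->
  exists2 d : R, 0 < d & forall s, \val s < d -> `|f s| < e.
Proof.
move=> [_ f0] /f0[K [cK Ke]].
have cvK : closed ((fun s : H => \val s) @` K).
  apply: compact_closed; first exact: Rhausdorff.
  apply: continuous_compact cK; exact/continuous_subspaceT/val_continuous.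
have nK0 : (~` ((fun s : H => \val s) @` K)) 0.
  by move=> [s _ s0]; have := half_open_itv s; rewrite s0 ltxx.
have /(_ _ nK0)/nbhs_ballP[d /= d0 dK] := closed_openC cvK.
exists d => // s sd; apply: Ke => Ks.
have : ball 0 d (\val s).
  have /andP[s0 _] := half_open_itv s.
  by rewrite /ball /= sub0r normrN gtr0_norm.
by move=> /dK; apply; exists s.
Qed.

Lemma radial_C0 (phi : R -> R) : continuous phi -> phi 0 = 0 ->
  C0 (fun s : H => (phi (\val s))%:C%C : C).
Proof.
move=> cphi phi0; split.
  move=> s; apply: (@continuous_comp _ _ _ (phi \o (fun s : H => \val s)) _).
    by apply: continuous_comp; [exact: val_continuous|exact: cphi].
  exact: real_complex_continuous.
move=> e e0.
have /complex_realP[e' ee'] : e \is Num.real by exact: gtr0_real.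
rewrite ee' in e0 *; have {}e0 : 0 < e' by rewrite -ltcR.
have /(cvgrPdist_lt _ _).1/(_ _ e0)/nbhs_ballP[d /= d0 dP] := cphi 0.
have d01 : 0 < Num.min d 1 <= 1 by rewrite lt_min d0 ltr01 ge_min lexx orbT.
exists (clip_half_open d01 @` `[Num.min d 1, 1]); split.
  apply: continuous_compact; last exact: segment_compact.
  exact/continuous_subspaceT/clip_half_open_continuous.
move=> s nKs.
have /andP[s0 s1] := half_open_itv s.
have sd : \val s < d.
  rewrite ltNge; apply/negP => ds; apply: nKs; exists (\val s).
    by rewrite /= in_itv /= s1 andbT ge_min ds.
  by apply/val_inj; rewrite clip_half_openK// ge_min ds s1.
rewrite normc_def /= expr0n addr0 sqrtr_sqr ltcR.
have := dP (\val s); rewrite /ball /= phi0 !sub0r !normrN; apply.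
by rewrite gtr0_norm.
Qed.

Context (G : topologicalGroupType).

Lemma cone_tens (f : H -> C) (k : G -> C) : C0 f -> continuous k ->
  cone_alg (tens f k).
Proof.
move=> f0 ck e e0; exists (tens f k); last first.
  by move=> p; rewrite subrr normr0 ltW.
exists 1%N, (fun=> f), (fun=> k); split=> //.
by rewrite big_ord1.
Qed.

(** What is needed of an element of the cone algebra: smallness near [0]
    uniformly in [G], which is stable under uniform limits. *)
Definition cone_fun (F : H * G -> C) := continuous F /\
  forall e : C, 0 < e ->
    exists2 d : R, 0 < d & forall s g, \val s < d -> `|F (s, g)| < e.

Lemma compact_Ccont_bounded (k : G -> C) : compact [set: G] -> continuous k ->
  exists2 M : C, 0 < M & forall g, `|k g| <= M.
Proof.
move=> /compact_near_coveringP cG ck.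
have : \forall M \near (+oo : set_system R),
    [set: G] `<=` (fun g => `|k g| <= M%:C%C).
  apply: cG => g _.
  have /complex_realP[r kr] : `|k g| \is Num.real by exact/ger0_real/normr_ge0.
  have k1 :=
    (@cvgrPdist_lt C C _ (nbhs g) (nbhs_filter g) k _).1 (ck g) _ ltr01.
  exists ([set g' | `|k g - k g'| < 1], [set M | r + 1 < M]).
    by split=> //; apply: nbhs_pinfty_gt; exact: num_real.
  move=> [g' M] /= [kg' rM].
  have -> : k g' = k g - (k g - k g') by rewrite subKr.
  apply: le_trans (ler_normB _ _) _.
  rewrite kr; apply: (@le_trans _ _ ((r + 1)%:C%C)); last by rewrite lecR ltW.
  by rewrite rmorphD lerD2l ltW.
move=> cov; have [M [M0 kM]] :=
  filter_ex (filterI (nbhs_pinfty_gt (num_real 0)) cov).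
by exists M%:C%C => [|g]; [rewrite ltcR|exact: kM].
Qed.

Lemma cone_fun_tens f k : compact [set: G] -> C0 f -> continuous k ->
  cone_fun (tens f k).
Proof.
move=> cG f0 ck; split=> [p|e e0].
  apply: (@cvgM C);
    (apply: continuous_comp; first by [exact: cvg_fst|exact: cvg_snd]).
    by case: f0 => cf _; exact: cf.
  exact: ck.
have [M M0 kM] := compact_Ccont_bounded cG ck.
have [d d0 dP] := C0_near0 f0 (divr_gt0 e0 M0).
exists d => // s g /dP fd.
rewrite /tens normrM.
apply: le_lt_trans (_ : `|f s| * M < e); first by rewrite ler_wpM2l.
by rewrite -ltr_pdivlMr.
Qed.

Lemma cone_algP F : compact [set: G] -> cone_alg F -> cone_fun F.
Proof.
move=> cG Fcone.
have tP H0 : alg_tensor (@C0 R H) (@Ccont R G) H0 -> cone_fun H0.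
  move=> [n [f [g [fg ->]]]]; apply: big_ind.
  - split; first exact: cst_continuous.
    by move=> e e0; exists 1 => // s g' _; rewrite normr0.
  - move=> F1 F2 [c1 v1] [c2 v2]; split.
      by move=> p; apply: (@cvgD C C); [exact: c1|exact: c2].
    move=> e e0; have e20 : 0 < e / 2 by rewrite divr_gt0.
    have [d1 d10 d1P] := v1 _ e20; have [d2 d20 d2P] := v2 _ e20.
    exists (Num.min d1 d2); first by rewrite lt_min d10.
    move=> s g'; rewrite lt_min => /andP[/d1P h1 /d2P h2].
    apply: le_lt_trans (ler_normD _ _) _.
    by rewrite [e]splitr ltrD.
  - by move=> i _; have [] := fg i; exact: cone_fun_tens.
split.
  move=> p; apply/(@cvgrPdist_lt C C _ (nbhs p) (nbhs_filter p)) => e e0.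
  have e30 : 0 < e / 3%:R by rewrite divr_gt0.
  have [H0 /tP[cH _] FH] := Fcone _ e30.
  have := (@cvgrPdist_lt C C _ (nbhs p) (nbhs_filter p) H0 _).1 (cH p) _ e30.
  apply: filterS => q Hpq.
  have -> : F p - F q = (F p - H0 p) + (H0 p - H0 q) - (F q - H0 q) by ring.
  have -> : e = e / 3%:R + e / 3%:R + e / 3%:R by field.
  apply: le_lt_trans (ler_normB _ _) _; apply: ltr_leD => //.
  apply: le_lt_trans (ler_normD _ _) _; exact: ler_ltD.
move=> e e0.
have e20 : 0 < e / 2 by rewrite divr_gt0.
have [H0 /tP[_ vH] FH] := Fcone _ e20.
have [d d0 dP] := vH _ e20.
exists d => // s g sd.
have -> : F (s, g) = (F (s, g) - H0 (s, g)) + H0 (s, g) by rewrite subrK.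
apply: le_lt_trans (ler_normD _ _) _.
by rewrite [e]splitr ler_ltD// dP.
Qed.

End Cone.

(** * Coordinates, equivariant maps and *-homomorphisms *)

Section Coordinates.
Context (R : realType) (G : topologicalGroupType) (X : topologicalType).
Context (act : X -> G -> X).
Local Notation C := (Cplx R).

(** Indexing by all of [nat] matches [weight] and [vertex] and avoids casts
    between ordinals in inductions; only the indices up to [n] count in the
    sum. *)
Record equivariant_coordinates (n : nat)
    (t : X -> nat -> R) (g : X -> nat -> G) : Prop := {
  coord_ge0 : forall x j, 0 <= t x j;
  coord_sum : forall x, \sum_(j < n.+1) t x j = 1;
  coord_continuous : forall j, continuous (t^~ j);
  coord_vertex : forall x j, 0 < t x j -> {for x, continuous (g^~ j)};
  coord_invariant : forall x h, t (act x h) = t x;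
  coord_equivariant : forall x j h, 0 < t x j ->
    g (act x h) j = (g x j * h)%g
}.

Lemma coord_le1 n t g x (j : 'I_n.+1) :
  equivariant_coordinates n t g -> t x j <= 1.
Proof.
move=> tg; rewrite -(coord_sum tg x) (bigD1 j) //= lerDl sumr_ge0// => i _.
exact: (coord_ge0 tg).
Qed.

Lemma equivariant_map_coordinates n (f : X -> EnG R G n) : continuous f ->
  (forall x h, f (act x h) = EnG_act (f x) h) ->
  equivariant_coordinates n (fun x => weight (f x)) (fun x => vertex (f x)).
Proof.
move=> cf fact; split.
- by move=> x j; exact: weight_ge0.
- by move=> x; exact: weight_sum.
- move=> j x; apply: (@continuous_comp _ _ _ f (fun q => weight q j)).
    exact: cf.
  exact: weight_continuous.
- move=> x j t0 U; rewrite /= nbhsE => -[V [oV Vx] VU].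
  have := @open_nbhs_nbhs _ (f x) _
    (conj (@open_vertex_preimage R G n j V oV) (conj t0 Vx)).
  by move=> /(cf x) Wx; apply: (@filterS _ (nbhs x) _ _ _ _ Wx) => y [_ /VU].
- by move=> x h; apply/funext => j; rewrite fact weight_act.
- by move=> x j h t0; rewrite fact vertex_act.
Qed.

Lemma coordinates_equivariant_map n t g : compact [set: G] ->
  equivariant_coordinates n t g ->
  let f x := EnG_point n (t x) (g x) in
  continuous f /\ forall x h, f (act x h) = EnG_act (f x) h.
Proof.
move=> cG tg f; split=> [x|x h].
- apply: EnG_point_continuous => //.
  + by move=> j; exact: (coord_continuous tg).
  + by near=> y => j; exact: (coord_ge0 tg).
  + by near=> y; exact: (coord_sum tg).
  + by move=> j; exact: (coord_vertex tg).
- rewrite /f (coord_invariant tg); apply: EnG_point_act => [j||j].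
  + exact: (coord_ge0 tg).
  + exact: (coord_sum tg).
  + exact: (coord_equivariant tg).
Unshelve. all: by end_near. Qed.

(** Evaluation at the point [(r, h)] of the cylinder over [G].  Elements of the
    cone algebra tend to [0] as [r] does, which dictates the value at [r = 0];
    the arguments [r] of interest lie in [[0,1]]. *)
Definition cone_eval (r : R) (h : G) (F : half_open R * G -> C) : C :=
  if pselect (`]0 : R, 1]%classic r) is left r01
  then F (SigSub (mem_set r01), h) else 0.

Lemma cone_evalE (s : half_open R) h F : cone_eval (\val s) h F = F (s, h).
Proof.
rewrite /cone_eval; case: pselect => [r01|]; last by case; exact: set_valP.
by congr (F (_, _)); apply/val_inj.
Qed.

Lemma cone_eval0 h F : cone_eval 0 h F = 0.
Proof.
rewrite /cone_eval; case: pselect => // r01.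
by exfalso; move: r01; rewrite /= in_itv /= ltxx.
Qed.

Lemma cone_evalP r h (a : C) F1 F2 :
  cone_eval r h (a *: F1 + F2) = a * cone_eval r h F1 + cone_eval r h F2.
Proof. by rewrite /cone_eval; case: pselect => // _; rewrite mulr0 addr0. Qed.

Lemma cone_evalM r h F1 F2 :
  cone_eval r h (F1 * F2) = cone_eval r h F1 * cone_eval r h F2.
Proof. by rewrite /cone_eval; case: pselect => // _; rewrite mulr0. Qed.

Lemma cone_eval_star r h F :
  cone_eval r h (fun p => (F p)^*) = (cone_eval r h F)^*.
Proof. by rewrite /cone_eval; case: pselect => // _; rewrite conjC0. Qed.

(** Where the weight vanishes, the uniform smallness of [F] makes the behaviour
    of the vertex irrelevant.  Elsewhere the weight stays above half its value,
    so that it can be clipped into [(0,1]] without changing anything nearby. *)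
Lemma cone_eval_cvg (x : X) (t : X -> R) (g : X -> G) F : cone_fun F ->
  (forall y, 0 <= t y <= 1) -> {for x, continuous t} ->
  (0 < t x -> {for x, continuous g}) ->
  {for x, continuous (fun y => cone_eval (t y) (g y) F)}.
Proof.
move=> [cF F0] t01 ct cg.
have /andP[tx0 tx1] := t01 x.
suff : (fun y => cone_eval (t y) (g y) F) @ x --> cone_eval (t x) (g x) F by [].
have [tx|tx] := eqVneq (t x) 0.
  rewrite tx cone_eval0.
  apply/(@cvgrPdist_lt C C _ (nbhs x) (nbhs_filter x)) => e e0.
  have [d d0 dP] := F0 _ e0.
  have := cvgr_lt _ ct d; rewrite tx => /(_ _ d0); apply: filterS => y tyd.
  rewrite sub0r normrN /cone_eval.
  case: pselect => [r01|_]; last by rewrite normr0.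
  exact: dP.
have {}tx0 : 0 < t x by rewrite lt_neqAle eq_sym tx.
have a01 : 0 < t x / 2 <= 1 by apply/andP; split; lra.
pose c (y : X) := clip_half_open a01 (t y).
have ctx : {for x, continuous (fun y => F (c y, g y))}.
  apply: (@continuous_comp _ _ _ (fun y => (c y, g y)) F); last exact: cF.
  apply: (@cvg_pair _ _ _ (nbhs x) (nbhs (c x)) (nbhs (g x))); last exact: cg.
  by apply: continuous_comp; [exact: ct|exact: clip_half_open_continuous].
have cE y : t x / 2 < t y -> cone_eval (t y) (g y) F = F (c y, g y).
  move=> ty; rewrite -cone_evalE clip_half_openK//.
  by have /andP[_ ->] := t01 y; rewrite ltW.
rewrite cE; last by lra.
apply: cvg_trans ctx; apply: near_eq_cvg.
have : \forall y \near x, t x / 2 < t y by apply: (cvgr_gt _ ct); lra.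
by apply: filterS => y /cE.
Qed.

Lemma coordinates_star_homs n t g : compact [set: G] ->
  equivariant_coordinates n t g ->
  let rho (j : 'I_n.+1) F x := cone_eval (t x j) (g x j) F in
  [/\ forall j, star_hom (@cone_alg R G) (@Ccont R X) (rho j),
      forall j h F, rho j (cone_action h F) = induced_action act h (rho j F) &
      \sum_(j < n.+1) rho j (tens (@t_incl R) (cst 1)) = cst 1].
Proof.
move=> cG tg rho; split.
- move=> j; split=> [F /(cone_algP cG) cF x|a F1 F2 _ _|F1 F2 _ _|F _].
  + apply: cone_eval_cvg => //.
    * by move=> y; rewrite (coord_ge0 tg)/= (coord_le1 _ _ tg).
    * exact: (coord_continuous tg).
    * exact: (coord_vertex tg).
  + by apply/funext => x; exact: cone_evalP.
  + by apply/funext => x; exact: cone_evalM.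
  + by apply/funext => x; exact: cone_eval_star.
- move=> j h F; apply/funext => x.
  rewrite /rho /induced_action (coord_invariant tg).
  rewrite /cone_eval; case: pselect => // r01.
  rewrite (coord_equivariant tg)//.
  by move: r01; rewrite /= in_itv => /andP[].
- apply/funext => x; rewrite fct_sumE.
  rewrite -[RHS](rmorph1 (real_complex R)) -(coord_sum tg x) rmorph_sum.
  apply: eq_bigr => j _; rewrite /rho /cone_eval; case: pselect => [r01|nr01].
    by rewrite /tens /t_incl /= mulr1.
  have [->|tj] := eqVneq (t x j) 0; first by rewrite rmorph0.
  case: nr01; rewrite /= in_itv /= lt_neqAle eq_sym tj /=.
  by rewrite (coord_ge0 tg) (coord_le1 _ _ tg).
Qed.

End Coordinates.

(** * Characters of C(K) *)

Section Character.
Context (R : realType) (K : topologicalType).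
Local Notation C := (Cplx R).

Lemma compact_separation (A : set K) (p : K) : compact [set: K] ->
  hausdorff_space K -> closed A -> ~ A p ->
  exists k : K -> C, [/\ continuous k, k p = 1 & forall q, A q -> k q = 0].
Proof.
move=> cK hK clA nAp.
have clp : closed [set p] by exact/accessible_closed_set1/hausdorff_accessible.
have Ap0 : A `&` [set p] = set0.
  by apply/seteqP; split=> // q [Aq qp]; rewrite qp in Aq.
have [f [cf f0 f1 _]] :=
  urysohn_ext_itv (compact_normal hK cK) clA clp Ap0 (@ltr01 R).
exists (fun q => (f q)%:C%C); split.
- move=> q; apply: continuous_comp; first exact: cf.
  exact: real_complex_continuous.
- by rewrite (f1 (f p) (imageP f _)).
- by move=> q Aq; rewrite (f0 (f q) (imageP f _)).
Qed.

(** The zero sets of the nonnegative functions in the kernel of [chi] generate a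
    filter: [h + l] vanishes exactly where both do, and a nowhere vanishing
    [h] would be invertible, contradicting [chi 1 = 1].  A cluster point of
    this filter is a common zero of these functions, and then
    [|k - chi k|^2], which is one of them, vanishes there. *)
Lemma character_point (chi : (K -> C) -> C) : compact [set: K] ->
  (forall (a : C) (k l : K -> C), continuous k -> continuous l ->
    chi (a *: k + l) = a * chi k + chi l) ->
  (forall k l : K -> C, continuous k -> continuous l ->
    chi (k * l) = chi k * chi l) ->
  (forall k : K -> C, continuous k -> chi (fun y => (k y)^*) = (chi k)^*) ->
  chi (cst 1) = 1 ->
  exists p, forall k : K -> C, continuous k -> chi k = k p.
Proof.
move=> cK chiP chiM chi_star chi1.
pose I (h : K -> C) := [/\ continuous h, chi h = 0 & forall y, 0 <= h y].
pose F (A : set K) := exists2 h, I h & [set y | h y = 0] `<=` A.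
have c0 : continuous (0 : K -> C) by exact: cst_continuous.
have c1 : continuous (cst 1 : K -> C) by exact: cst_continuous.
have chi0 : chi 0 = 0.
  by have := chiP (-1) 0 0 c0 c0; rewrite scaler0 addr0 mulN1r addNr.
have FF : Filter F.
  split.
  - by exists 0.
  - move=> A B [h [ch h0 hge] hA] [l [cl l0 lge] lB].
    exists (1 *: h + l).
      split; [|by rewrite (chiP _ _ _ ch cl) h0 l0 mulr0 addr0|].
        by move=> y; rewrite scale1r; apply: (@cvgD C C); [exact: ch|exact: cl].
      by move=> y; rewrite scale1r addr_ge0.
    move=> y /=; rewrite scale1r => /eqP.
    rewrite [(h + l) y]/(h y + l y) paddr_eq0// => /andP[/eqP hy /eqP ly].
    by split; [exact: hA|exact: lB].
  - by move=> A B AB [h Ih hA]; exists h => //; apply: subset_trans AB.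
have PF : ProperFilter F.
  split=> // -[h [ch h0 _] hne].
  have hne' y : h y != 0 by apply/eqP => /hne.
  have chV : continuous (fun y => (h y)^-1 : C).
    by move=> y; apply: cvgV; [exact: hne'|exact: ch].
  have := chiM _ _ ch chV; rewrite h0 mul0r.
  rewrite (_ : h * _ = cst 1) ?chi1; last first.
    by apply/funext => y; exact: divff.
  by move/eqP; rewrite oner_eq0.
have [p [_ clp]] := cK F PF filterT.
exists p => k ck.
(* The scalar 1 puts k - chi k in the form to which linearity applies. *)
pose k' := 1 *: k + cst (- chi k).
have ck' : continuous k'.
  move=> y; rewrite /k' scale1r.
  by apply: (@cvgD C C); [exact: ck|exact: cvg_cst].
have chik' : chi k' = 0.
  have c1x : cst (- chi k) = (- chi k) *: cst 1 + 0 :> (K -> C).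
    by apply/funext => y; rewrite addr0; symmetry; exact: mulr1.
  have cc : continuous (cst (- chi k) : K -> C) by exact: cst_continuous.
  rewrite (chiP _ _ _ ck cc).
  by rewrite c1x (chiP _ _ _ c1 c0) chi0 chi1 mul1r mulr1 addr0 subrr.
have cks : continuous (fun y => (k' y)^* : C).
  move=> y; apply: (@continuous_comp _ _ _ k' _); first exact: ck'.
  exact: conj_continuous.
pose h := k' * (fun y => (k' y)^*).
have ch : continuous h by move=> y; apply: (@cvgM C); [exact: ck'|exact: cks].
have Ih : I h.
  split; [exact: ch|by rewrite (chiM _ _ ck' cks) chik' mul0r|].
  by move=> y; rewrite [h y]/(k' y * (k' y)^*) mul_conjC_ge0.
have hp : h p = 0.
  apply/eqP/negPn/negP => hp0.
  have nB : nbhs p [set y | h y != 0].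
    exact: (@cvgr_neq0 C C K (nbhs p) (nbhs_filter p) h (h p) (ch p) hp0).
  have [y [/= hy0]] := clp _ _ (ex_intro2 _ _ h Ih (fun y e => e)) nB.
  by rewrite hy0 eqxx.
move: hp; rewrite [h p]/(k' p * (k' p)^*) => /eqP; rewrite mul_conjC_eq0.
by rewrite [k' p]/(1 * k p - chi k) mul1r subr_eq0 => /eqP.
Qed.

End Character.

(** * Recovering coordinates from *-homomorphisms *)

Section StarHom.
Context (R : realType) (G : topologicalGroupType) (X : topologicalType).
Local Notation C := (Cplx R).
Local Notation H := (half_open R).
Context (rho : (H * G -> C) -> X -> C).
Context (rhoP : star_hom (@cone_alg R G) (@Ccont R X) rho).
Local Notation t := (@t_incl R).

Lemma t_C0 : C0 t.
Proof. by apply: (@radial_C0 R id) => // r; exact: cvg_id. Qed.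

Lemma cone_t (k : G -> C) : continuous k -> cone_alg (tens t k).
Proof. exact/cone_tens/t_C0. Qed.

Let c1 : continuous (cst 1 : G -> C).
Proof. exact: cst_continuous. Qed.

(** The multiplicativity of [k |-> rho (t (x) k) / rho (t (x) 1)], written without
    division so that it also makes sense where the denominator vanishes. *)
Lemma star_hom_tM (k l : G -> C) x : continuous k -> continuous l ->
  rho (tens t k) x * rho (tens t l) x =
  rho (tens t (cst 1)) x * rho (tens t (k * l)) x.
Proof.
move=> ck cl.
have ckl : continuous (k * l).
  by move=> y; apply: (@cvgM C); [exact: ck|exact: cl].
have := star_hom_mul rhoP (cone_t ck) (cone_t cl).
have -> : tens t k * tens t l = tens t (cst 1) * tens t (k * l).
  have mulE (a b c : C) : a * b * (a * c) = a * 1 * (a * (b * c)).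
    by rewrite mulrACA mulr1 -mulrA.
  by apply/funext => p; exact: mulE.
rewrite (star_hom_mul rhoP (cone_t c1) (cone_t ckl)).
by move=> /(congr1 (fun f => f x)).
Qed.

Lemma star_hom_t_star (k : G -> C) x : continuous k ->
  rho (tens t (fun y => (k y)^*)) x = (rho (tens t k) x)^*.
Proof.
move=> ck; have := star_hom_star rhoP (cone_t ck).
have -> : (fun p => (tens t k p)^*) = tens t (fun y => (k y)^*).
  apply/funext => p; rewrite /tens rmorphM; congr (_ * _).
  by rewrite /t_incl; apply/CrealP; apply/complex_realP; exists (\val p.1).
by move=> ->.
Qed.

(** [t] is the square of the real function [sqrt t], which is again in [C_0]. *)
Lemma star_hom_t_ge0 x : 0 <= rho (tens t (cst 1)) x.
Proof.
pose r := (fun s : H => (Num.sqrt (\val s))%:C%C : C).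
have r0 : C0 r by apply: radial_C0; [exact: sqrt_continuous|exact: sqrtr0].
have cr : cone_alg (tens r (cst 1 : G -> C)) by exact: cone_tens.
have rE : tens r (cst 1) = (fun p => (tens r (cst 1 : G -> C) p)^*).
  apply/funext => p; rewrite /tens /r mulr1; symmetry; apply/CrealP.
  by apply/complex_realP; eexists.
have -> : tens t (cst 1) = tens r (cst 1 : G -> C) * tens r (cst 1 : G -> C).
  have sqE (a b : C) : a = b * b -> a * 1 = b * 1 * (b * 1) by rewrite !mulr1.
  apply/funext => p; apply: sqE.
  have /andP[/ltW p0 _] := half_open_itv p.1.
  by rewrite /r -rmorphM -expr2 sqr_sqrtr.
rewrite (star_hom_mul rhoP cr cr) {2}rE (star_hom_star rhoP cr).
exact: mul_conjC_ge0.
Qed.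

(** The formula also holds where the weight vanishes: there
    [|rho (t (x) k)|^2 = rho (t (x) 1) * rho (t (x) |k|^2) = 0], so any vertex
    will do. *)
Lemma star_hom_polar : compact [set: G] -> exists (tau : X -> R) (gam : X -> G),
  [/\ forall x, 0 <= tau x, continuous tau &
      forall x (k : G -> C), continuous k ->
        rho (tens t k) x = (tau x)%:C%C * k (gam x)].
Proof.
move=> cG.
pose T := rho (tens t (cst 1)).
have cT : continuous T by exact: (star_hom_fun rhoP (cone_t c1)).
pose tau x : R := complex.Re (T x).
have TE x : T x = (tau x)%:C%C.
  by rewrite RRe_real//; apply: ger0_real; exact: star_hom_t_ge0.
have gamP x : exists g, forall k, continuous k -> rho (tens t k) x = T x * k g.
  have [Tx0|Tx0] := eqVneq (T x) 0.
    exists 1%g => k ck; rewrite Tx0 mul0r; apply/eqP; rewrite -mul_conjC_eq0.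
    have cks : continuous (fun y => (k y)^* : C).
      move=> y; apply: (@continuous_comp _ _ _ k _); first exact: ck.
      exact: conj_continuous.
    by rewrite -(star_hom_t_star _ ck) (star_hom_tM _ ck cks) -/T Tx0 mul0r.
  have [||||g gP] := @character_point R G (fun k => rho (tens t k) x / T x) cG.
  - move=> a k l ck cl.
    have -> : tens t (a *: k + l) = a *: tens t k + tens t l.
      have mulE (b c d : C) : b * (a * c + d) = a * (b * c) + b * d.
        by rewrite mulrDr mulrCA.
      by apply/funext => p; exact: mulE.
    rewrite (star_hom_linear rhoP _ (cone_t ck) (cone_t cl)).
    have mulE (b c d : C) : (a * b + c) / d = a * (b / d) + c / d.
      by rewrite mulrDl mulrA.
    exact: mulE.
  - move=> k l ck cl; rewrite mulf_div (star_hom_tM _ ck cl) -/T -mulf_div.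
    by rewrite divff// mul1r.
  - move=> k ck; rewrite (star_hom_t_star _ ck) rmorphM fmorphV; congr (_ / _).
    by symmetry; apply/CrealP/ger0_real; exact: star_hom_t_ge0.
  - by rewrite divff.
  by exists g => k ck; rewrite -(gP _ ck) mulrC divfK.
have [gam {}gamP] := choice gamP.
exists tau, gam; split.
- by move=> x; rewrite -ler0c -TE; exact: star_hom_t_ge0.
- move=> x; apply: (@continuous_comp _ _ _ T); first exact: cT.
  exact: Re_continuous.
- by move=> x k ck; rewrite (gamP _ _ ck) TE.
Qed.

End StarHom.

Section Converse.
Context (R : realType) (G : topologicalGroupType) (X : topologicalType).
Context (act : X -> G -> X).
Local Notation C := (Cplx R).
Local Notation H := (half_open R).
Local Notation t := (@t_incl R).

(** If [V] is an open neighbourhood of [gam x] and [k] is a Urysohn function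
    with [k (gam x) = 1] that vanishes outside of [V], then [gam] stays in [V]
    as long as the continuous function [rho (t (x) k)] does not vanish. *)
Lemma polar_vertex_continuous (rho : (H * G -> C) -> X -> C)
    (tau : X -> R) (gam : X -> G) x :
  compact [set: G] -> hausdorff_space G ->
  star_hom (@cone_alg R G) (@Ccont R X) rho ->
  (forall x (k : G -> C), continuous k ->
    rho (tens t k) x = (tau x)%:C%C * k (gam x)) ->
  0 < tau x -> {for x, continuous gam}.
Proof.
move=> cG hG rhoP rhoE tx U; rewrite /= nbhsE => -[V [oV Vx] VU].
have [k [ck kx k0]] := @compact_separation R G (~` V) (gam x) cG hG
  (open_closedC oV) (fun nV => nV Vx).
have cr : continuous (rho (tens t k)) by exact: (star_hom_fun rhoP (cone_t ck)).
have nB : nbhs x [set y | rho (tens t k) y != 0].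
  apply: (@cvgr_neq0 C C X (nbhs x) (nbhs_filter x) _ _ (cr x)).
  rewrite (rhoE _ _ ck) kx mulr1; apply/eqP => /(congr1 (@complex.Re R)) /= tx0.
  by rewrite tx0 ltxx in tx.
apply: (@filterS _ (nbhs x) _ _ _ _ nB) => y /= ry; apply: VU.
apply: contrapT => nVy; move: ry.
by rewrite (rhoE _ _ ck) (k0 _ nVy) mulr0 eqxx.
Qed.

(** Equivariance of [rho] tested on [t (x) k] compares [k (gam (x h))] with
    [k (gam x * h)]; taking [k = 1] gives invariance of the weights, and then
    functions separating points give equivariance of the vertices. *)
Lemma star_homs_coordinates n (rho : 'I_n.+1 -> (H * G -> C) -> X -> C) :
  compact [set: G] -> hausdorff_space G ->
  (forall j, star_hom (@cone_alg R G) (@Ccont R X) (rho j)) ->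
  (forall j h F, cone_alg F ->
    rho j (cone_action h F) = induced_action act h (rho j F)) ->
  \sum_(j < n.+1) rho j (tens t (cst 1)) = cst 1 ->
  exists (tau : X -> nat -> R) (gam : X -> nat -> G),
    equivariant_coordinates act n tau gam.
Proof.
move=> cG hG rhoP rho_act rho1.
have [tau tauP] := choice (fun j => star_hom_polar (rhoP j) cG).
have [gam {}tauP] := choice tauP.
have c1 : continuous (cst 1 : G -> C) by exact: cst_continuous.
have eqv j x h (k : G -> C) : continuous k ->
    (tau j (act x h))%:C%C * k (gam j (act x h)) =
    (tau j x)%:C%C * k (gam j x * h)%g :> C.
  move=> ck; have [_ _ E] := tauP j; rewrite -(E _ _ ck).
  have ckh : continuous (fun g : G => k (g * h)%g).
    move=> g; apply: (@continuous_comp _ _ _ (fun g : G => (g * h)%g) k).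
      apply: (@continuous_comp _ _ _ (fun g : G => (g, h))
        (fun p : G * G => (p.1 * p.2)%g)).
        by apply: cvg_pair => //=; exact: cvg_cst.
      exact: mulg_continuous.
    exact: ck.
  rewrite -(E x (fun g => k (g * h)%g) ckh).
  by have /(congr1 (fun f => f x)) := rho_act j h _ (cone_t ck).
have inv j x h : tau j (act x h) = tau j x.
  by have := eqv j x h _ c1; rewrite !mulr1 => /complexI.
exists (fun x j => tau (inord j) x), (fun x j => gam (inord j) x); split.
- by move=> x j; have [] := tauP (inord j).
- move=> x; apply: (@complexI R); rewrite rmorph1 rmorph_sum.
  have := congr1 (fun f => f x) rho1; rewrite fct_sumE /= => <-.
  apply: eq_bigr => j _; have [_ _ E] := tauP j.
  by rewrite (E _ _ c1) mulr1 inord_val.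
- by move=> j; have [] := tauP (inord j).
- move=> x j tx; have [_ _ E] := tauP (inord j).
  exact: (polar_vertex_continuous cG hG (rhoP (inord j)) E).
- by move=> x h; apply/funext => j; rewrite inv.
- move=> x j h tx; apply: contrapT => ne.
  have clg : closed [set (gam (inord j) x * h)%g].
    exact/accessible_closed_set1/hausdorff_accessible.
  have [k [ck k1 k0]] := compact_separation R cG hG clg ne.
  have := eqv (inord j) x h k ck; rewrite inv k1 (k0 _ erefl) mulr0 mulr1.
  by move=> /(congr1 (@complex.Re R)) /= tx0; rewrite tx0 ltxx in tx.
Qed.

End Converse.

(** * The index and the local-triviality dimension *)

Theorem theorem4p5 (R : realType) (G : topologicalGroupType)
    (X : topologicalType) (act : X -> G -> X)
    (compactG : compact [set: G]) (hausdorffG : hausdorff_space G)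
    (compactX : compact [set: X]) (hausdorffX : hausdorff_space X)
    (act_cont : continuous_right_action act) :
  ind R act = dim_LT (@Ccont R X) (@induced_action R G X act).
Proof.
rewrite /ind /dim_LT; congr least; apply/funext => n; apply/propext; split.
- move=> [f [cf fact]].
  have tg := equivariant_map_coordinates cf fact.
  have [rhoP rho_act rho1] := coordinates_star_homs compactG tg.
  by eexists; split; [exact: rhoP|move=> j h F _; exact: rho_act|exact: rho1].
- move=> [rho [rhoP rho_act rho1]].
  have [t [g tg]] :=
    star_homs_coordinates compactG hausdorffG rhoP rho_act rho1.
  by eexists; exact: (coordinates_equivariant_map compactG tg).
Qed.
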